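(* Let $A$ be a self-adjoint matrix in $M_n(\mathbb{C})$. Then $\|A\|_{\mathcal{S}^*}\le 1$ if and only if there exists a vector $\gamma\in\mathbb{R}^n$ such that each $\gamma_j\ge 0$, $\gamma_1+\dots+\gamma_n=1$ and $$-\Delta(\gamma)\le A\le \Delta(\gamma).$$
   Context: $\|\cdot\|_\infty$ on $M_n(\mathbb{C})$ is the operator norm. The Schur product is the entrywise product $(X\circ Y)_{(i,j)}=X_{(i,j)}Y_{(i,j)}$, and the Schur multiplier norm is $\|X\|_S=\sup\{\|X\circ Y\|_\infty : Y\in M_n(\mathbb{C}),\ \|Y\|_\infty\le 1\}$. Its dual norm is $\|X\|_{\mathcal{S}^*}=\sup\{|\mathrm{Tr}_n(Y^*X)| : Y\in M_n(\mathbb{C}),\ \|Y\|_S\le 1\}$, where $\mathrm{Tr}_n$ is the (unnormalized) trace. For a vector $\lambda\in\mathbb{C}^n$, $\Delta(\lambda)$ denotes the diagonal $n\times n$ matrix with diagonal entries $\lambda_1,\dots,\lambda_n$. For self-adjoint $C,D$ the relation $C\le D$ means $D-C$ is positive semidefinite. *)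

(* Defs.v *)
From HB Require Import structures.
From mathcomp Require Import all_boot all_order all_algebra.
From mathcomp Require Import all_classical reals.
From mathcomp Require Export complex.
From mathcomp Require Import sesquilinear spectral.

Set Implicit Arguments.
Unset Strict Implicit.
Unset Printing Implicit Defensive.
Import Order.TTheory GRing.Theory Num.Theory.

Local Open Scope classical_set_scope.
Local Open Scope ring_scope.
Local Open Scope complex_scope.
Local Open Scope sesquilinear_scope.

(* [Normc.normc z : R] is the modulus; the generic norm [`|z|] of [R[i]]
   takes its values in [R[i]]. *)
Definition cmod (R : realType) (z : R[i]) : R := Normc.normc z.

Definition l2norm (R : realType) (n : nat) (v : 'cV[R[i]]_n) : R :=
  Num.sqrt (\sum_(i < n) cmod (v i 0) ^+ 2).

Definition opnorm (R : realType) (n : nat) (X : 'M[R[i]]_n) : R :=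
  sup [set l2norm (X *m v) | v in [set v : 'cV[R[i]]_n | l2norm v <= 1]].

Definition schurmx (R : realType) (n : nat) (X Y : 'M[R[i]]_n) : 'M[R[i]]_n :=
  map2_mx *%R X Y.

Definition schur_norm (R : realType) (n : nat) (X : 'M[R[i]]_n) : R :=
  sup [set opnorm (schurmx X Y) | Y in [set Y : 'M[R[i]]_n | opnorm Y <= 1]].

Definition schur_dual_norm (R : realType) (n : nat) (X : 'M[R[i]]_n) : R :=
  sup [set cmod (\tr (Y ^t* *m X)) |
       Y in [set Y : 'M[R[i]]_n | schur_norm Y <= 1]].

(* In [R[i]], [0 <= z] means that [z] is real and nonnegative. *)
Definition psdmx (R : realType) (n : nat) (P : 'M[R[i]]_n) : Prop :=
  P \is hermsymmx /\
  forall v : 'cV[R[i]]_n, 0 <= (v ^t* *m P *m v) 0 0.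

Definition loewner_le (R : realType) (n : nat) (C D : 'M[R[i]]_n) : Prop :=
  psdmx (D - C).

(* [sup] is 0 by convention on sets that are empty or unbounded above; the
   lemmas [has_sup_*] below show that this never happens here, so the three
   norms are genuine suprema. *)
Section NormsAreSuprema.
Context (R : realType) (n : nat).
Implicit Types (X Y : 'M[R[i]]_n) (v : 'cV[R[i]]_n).

Let cmodE (z : R[i]) : (cmod z)%:C = `|z|.
Proof. by rewrite normc_def; case: z. Qed.

Lemma cmod_ge0 (z : R[i]) : 0 <= cmod z.
Proof. by rewrite -lecR cmodE normr_ge0. Qed.

Lemma cmod0 : cmod (0 : R[i]) = 0.
Proof. exact: Normc.normc0. Qed.

Lemma cmodM (z w : R[i]) : cmod (z * w) = cmod z * cmod w.
Proof. exact: Normc.normcM. Qed.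

Lemma cmod_conj (z : R[i]) : cmod (Num.conj z) = cmod z.
Proof. by apply: complexI; rewrite !cmodE norm_conjC. Qed.

Lemma cmod_sum (I : finType) (F : I -> R[i]) :
  cmod (\sum_i F i) <= \sum_i cmod (F i).
Proof.
rewrite -lecR cmodE rmorph_sum /=.
under [leRHS]eq_bigr do rewrite cmodE.
exact: ler_norm_sum.
Qed.

Lemma cmod_le_l2norm v i : cmod (v i 0) <= l2norm v.
Proof.
rewrite -(ger0_norm (cmod_ge0 _)) -sqrtr_sqr ler_wsqrtr // (bigD1 i) //=.
by rewrite lerDl sumr_ge0 // => j _; rewrite sqr_ge0.
Qed.

Lemma l2norm_le_sum v : l2norm v <= \sum_i cmod (v i 0).
Proof.
have S0 : 0 <= \sum_i cmod (v i 0) by apply: sumr_ge0 => i _; exact: cmod_ge0.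
rewrite -(ger0_norm S0) -sqrtr_sqr ler_wsqrtr // expr2 mulr_suml.
apply: ler_sum => i _; rewrite expr2 ler_wpM2l ?cmod_ge0 //.
by rewrite (bigD1 i) //= lerDl sumr_ge0 // => j _; exact: cmod_ge0.
Qed.

Lemma l2norm_delta i : l2norm (delta_mx i 0 : 'cV[R[i]]_n) = 1.
Proof.
rewrite /l2norm (bigD1 i) //= mxE !eqxx big1 => [|j ji].
  by rewrite addr0 /cmod Normc.normc1 expr1n sqrtr1.
by rewrite mxE (negPf ji) cmod0 expr0n.
Qed.

Lemma l2norm_mulmx_le X v : l2norm v <= 1 ->
  l2norm (X *m v) <= \sum_i \sum_j cmod (X i j).
Proof.
move=> v1; apply: (le_trans (l2norm_le_sum _)); apply: ler_sum => i _.
rewrite mxE; apply: (le_trans (cmod_sum _)); apply: ler_sum => j _.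
rewrite cmodM ler_piMr ?cmod_ge0 //.
exact: le_trans (cmod_le_l2norm _ _) v1.
Qed.

Lemma has_sup_opnorm X :
  has_sup [set l2norm (X *m v) | v in [set v : 'cV[R[i]]_n | l2norm v <= 1]].
Proof.
split.
  exists (l2norm (X *m 0)), 0 => //=.
  rewrite /l2norm big1 ?sqrtr0 ?ler01 // => i _.
  by rewrite mxE cmod0 expr0n.
by exists (\sum_i \sum_j cmod (X i j)) => _ [v /= v1 <-];
  exact: l2norm_mulmx_le.
Qed.

Lemma opnorm_le_sum X : opnorm X <= \sum_i \sum_j cmod (X i j).
Proof.
apply: ge_sup; first by case: (has_sup_opnorm X).
by move=> _ [v /= v1 <-]; exact: l2norm_mulmx_le.
Qed.

Lemma cmod_le_opnorm X i j : cmod (X i j) <= opnorm X.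
Proof.
apply: (@le_trans _ _ (l2norm (X *m delta_mx j 0))); last first.
  apply: ub_le_sup; first by case: (has_sup_opnorm X).
  by exists (delta_mx j 0) => //=; rewrite l2norm_delta.
by apply: le_trans (cmod_le_l2norm _ i); rewrite -colE mxE.
Qed.

Lemma opnorm_schurmx_le X Y : opnorm Y <= 1 ->
  opnorm (schurmx X Y) <= \sum_i \sum_j cmod (X i j).
Proof.
move=> Y1; apply: (le_trans (opnorm_le_sum _)).
apply: ler_sum => i _; apply: ler_sum => j _.
rewrite mxE cmodM ler_piMr ?cmod_ge0 //.
exact: le_trans (cmod_le_opnorm _ _ _) Y1.
Qed.

Lemma opnorm_delta_le1 i j : opnorm (delta_mx i j : 'M[R[i]]_n) <= 1.
Proof.
apply: (le_trans (opnorm_le_sum _)).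
rewrite (bigD1 i) //= (bigD1 j) //= mxE !eqxx /cmod Normc.normc1.
rewrite big1 => [|k kj]; last by rewrite mxE (negPf kj) andbF Normc.normc0.
rewrite big1 ?addr0 // => k ki; rewrite big1 // => l _.
by rewrite mxE (negPf ki) Normc.normc0.
Qed.

Lemma opnorm0 : opnorm (0 : 'M[R[i]]_n) <= 0.
Proof.
apply: (le_trans (opnorm_le_sum _)).
by rewrite big1 // => i _; rewrite big1 // => j _; rewrite mxE cmod0.
Qed.

Lemma has_sup_schur_norm X :
  has_sup [set opnorm (schurmx X Y) | Y in [set Y : 'M[R[i]]_n | opnorm Y <= 1]].
Proof.
split; last first.
  by exists (\sum_i \sum_j cmod (X i j)) => _ [Y /= Y1 <-];
    exact: opnorm_schurmx_le.
exists (opnorm (schurmx X 0)), 0 => //=.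
exact: le_trans opnorm0 ler01.
Qed.

Lemma cmod_le_schur_norm X i j : cmod (X i j) <= schur_norm X.
Proof.
apply: (@le_trans _ _ (opnorm (schurmx X (delta_mx i j)))); last first.
  apply: ub_le_sup; first by case: (has_sup_schur_norm X).
  by exists (delta_mx i j) => //=; exact: opnorm_delta_le1.
by apply: le_trans (cmod_le_opnorm _ i j); rewrite !mxE !eqxx mulr1.
Qed.

Lemma has_sup_schur_dual_norm X :
  has_sup [set cmod (\tr (Y ^t* *m X)) |
           Y in [set Y : 'M[R[i]]_n | schur_norm Y <= 1]].
Proof.
split.
  exists (cmod (\tr ((0 : 'M[R[i]]_n) ^t* *m X))), 0 => //=.
  apply: ge_sup; first by case: (has_sup_schur_norm (0 : 'M[R[i]]_n)).
  move=> _ [Y /= Y1 <-]; apply: (le_trans (opnorm_schurmx_le _ Y1)).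
  by rewrite big1 ?ler01 // => i _; rewrite big1 // => j _; rewrite mxE cmod0.
exists (\sum_i \sum_j cmod (X j i)) => _ [Y /= Y1 <-].
apply: (le_trans (cmod_sum _)); apply: ler_sum => i _.
rewrite mxE; apply: (le_trans (cmod_sum _)); apply: ler_sum => j _.
rewrite !mxE cmodM cmod_conj ler_piMl ?cmod_ge0 //.
exact: le_trans (cmod_le_schur_norm _ _ _) Y1.
Qed.

End NormsAreSuprema.

(* Main.v *)
Require Import Defs.
From mathcomp Require Import all_boot all_order all_algebra.
From mathcomp Require Import all_classical reals sesquilinear spectral.
From mathcomp Require Import topology normedtype.
Import numFieldNormedType.Exports.
From mathcomp Require Import ring lra.

Set Implicit Arguments.
Unset Strict Implicit.
Unset Printing Implicit Defensive.
Import Order.TTheory GRing.Theory Num.Theory.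

Local Open Scope ring_scope.
Local Open Scope complex_scope.
Local Open Scope sesquilinear_scope.

(** Let [K] be the set of hermitian matrices [X] such that
    [- diag gamma <= X <= diag gamma] for some nonnegative [gamma] of total
    weight at most 1 ([diag_dominated]). The theorem says that [K] is the set of
    hermitian matrices in the unit ball of the dual norm; the proof shows that [K]
    is a closed convex set and that every hermitian [Y] whose pairing with [K] is
    at most 1 has Schur norm at most 1.

    If [A] is in [K], put [D = diag (sqrt gamma)] and write [A = D B D], where [B]
    is a contraction. Then [\tr (Y^* A)] is, up to conjugation, the form of the
    Schur product of [Y] with the conjugate of [B], evaluated at the vector
    [sqrt gamma], which has norm at most 1; hence it is bounded by the Schur norm
    of [Y] ([schur_dual_norm_dominated]).

    Conversely, the pairing of a hermitian [Y] with [K] controls its Schur norm: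
    for a contraction [B] and vectors [v], [w] in the unit ball, the number
    [Re <(Y o B) v, w>] is the pairing of [Y] with the hermitian part of a matrix
    built from [B], [v] and [w], and this hermitian part is in [K] for the weight
    [(|v|^2 + |w|^2) / 2] by the inequality between the two means
    ([schur_norm_polar]). Thus, if [A] is not in [K], a hyperplane separating [A]
    from [K] ([separation]) gives a [Y] of Schur norm at most 1 whose pairing with
    [A] exceeds 1 ([diag_dominated_of_schur_dual]).

    Separation asks for a positive distance between [A] and [K], that is, for
    [K] to be closed; this comes from the compactness of the cube of weights
    ([diag_dominated_closed]). *)

(** * The real inner product on complex matrices *)

Definition rdot (R : realType) (z w : R[i]) : R :=
  complex.Re z * complex.Re w + complex.Im z * complex.Im w.

(** The real part of the trace pairing, in coordinates: see [ip_tr]. Working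
    with a real symmetric bilinear form makes most estimates linear
    arithmetic. *)
Definition ip (R : realType) (m n : nat) (X Y : 'M[R[i]]_(m, n)) : R :=
  \sum_i \sum_j rdot (X i j) (Y i j).

Lemma conjCE (R : realType) (a b : R) : Num.conj (a +i* b) = a -i* b.
Proof. by []. Qed.

Lemma conj_real (R : realType) (a : R) : Num.conj a%:C = a%:C.
Proof. by rewrite conjCE oppr0. Qed.

Section RealInnerProduct.
Context (R : realType).
Implicit Types z w : R[i].

Lemma rdotC z w : rdot z w = rdot w z.
Proof. by rewrite /rdot; ring. Qed.

Lemma rdotDl z1 z2 w : rdot (z1 + z2) w = rdot z1 w + rdot z2 w.
Proof. by case: z1 z2 w => [? ?] [? ?] [? ?]; rewrite /rdot /=; ring. Qed.

Lemma rdotZl (a : R) z w : rdot (a%:C * z) w = a * rdot z w.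
Proof. by case: z w => [? ?] [? ?]; rewrite /rdot /=; ring. Qed.

Lemma rdot_conj z w : rdot (Num.conj z) (Num.conj w) = rdot z w.
Proof. by case: z w => [? ?] [? ?]; rewrite !conjCE /rdot /=; ring. Qed.

Lemma rdotMl z1 z2 w : rdot (z1 * z2) w = rdot z1 (w * Num.conj z2).
Proof.
by case: z1 z2 w => [? ?] [? ?] [? ?]; rewrite !conjCE /rdot /=; ring.
Qed.

Lemma rdot_cmod z : rdot z z = cmod z ^+ 2.
Proof.
by case: z => a b; rewrite /rdot /cmod /= sqr_sqrtr ?addr_ge0 ?sqr_ge0 ?expr2.
Qed.

Lemma rdot_Re z w : rdot z w = complex.Re (Num.conj w * z).
Proof. by case: z w => [? ?] [? ?]; rewrite conjCE /rdot /=; ring. Qed.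

Variables m n : nat.
Implicit Types X Y Z : 'M[R[i]]_(m, n).

Lemma ipC X Y : ip X Y = ip Y X.
Proof. by do 2![apply: eq_bigr => ? _]; rewrite rdotC. Qed.

Lemma ipDl X Y Z : ip (X + Y) Z = ip X Z + ip Y Z.
Proof.
rewrite -big_split; apply: eq_bigr => i _ /=; rewrite -big_split.
by apply: eq_bigr => j _ /=; rewrite mxE rdotDl.
Qed.

Lemma ipZl (a : R) X Z : ip (a%:C *: X) Z = a * ip X Z.
Proof.
rewrite /ip mulr_sumr; apply: eq_bigr => i _; rewrite mulr_sumr.
by apply: eq_bigr => j _; rewrite mxE rdotZl.
Qed.

Lemma ipNl X Z : ip (- X) Z = - ip X Z.
Proof. by rewrite -scaleN1r -[-1]/(- 1%:C) -rmorphN ipZl mulN1r. Qed.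

Lemma ipDr X Y Z : ip Z (X + Y) = ip Z X + ip Z Y.
Proof. by rewrite ipC ipDl !(ipC Z). Qed.

Lemma ipZr (a : R) X Z : ip Z (a%:C *: X) = a * ip Z X.
Proof. by rewrite ipC ipZl ipC. Qed.

Lemma ipNr X Z : ip Z (- X) = - ip Z X.
Proof. by rewrite ipC ipNl ipC. Qed.

Definition ip_lin := (ipDl, ipDr, ipNl, ipNr, ipZl, ipZr).

Lemma ip_ge0 X : 0 <= ip X X.
Proof. by do 2![apply: sumr_ge0 => ? _]; rewrite rdot_cmod sqr_ge0. Qed.

Lemma ip_amgm X Y : 2 * ip X Y <= ip X X + ip Y Y.
Proof. by have := ip_ge0 (X - Y); rewrite !ip_lin (ipC Y X); lra. Qed.

Lemma ip_adj X Y : ip (X ^t*) (Y ^t*) = ip X Y.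
Proof.
rewrite /ip exchange_big; do 2![apply: eq_bigr => ? _].
by rewrite !mxE rdot_conj.
Qed.

Lemma ip_tr X Y : ip X Y = complex.Re (\tr (Y ^t* *m X)).
Proof.
rewrite /ip exchange_big /= [RHS]raddf_sum; apply: eq_bigr => j _.
rewrite mxE [RHS]raddf_sum; apply: eq_bigr => i _ /=.
by rewrite !mxE rdot_Re.
Qed.

End RealInnerProduct.

(** * Adjoints and the operator, Schur and dual norms *)

Section Norms.
Context (R : realType).

Lemma adjmxM m n p (X : 'M[R[i]]_(m, n)) (Y : 'M_(n, p)) :
  (X *m Y) ^t* = Y ^t* *m X ^t*.
Proof. by rewrite trmx_mul map_mxM. Qed.

Lemma adjmxK m n (X : 'M[R[i]]_(m, n)) : X ^t* ^t* = X.
Proof. by apply/matrixP => i j; rewrite !mxE conjCK. Qed.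

(** Taking [Y] to be a column vector and [Z] a column vector turns a pairing
    against a rank one matrix into a pairing of vectors. *)
Lemma ip_mulmxl m n p (X : 'M[R[i]]_(m, n)) (Y : 'M_(n, p)) Z :
  ip (X *m Y) Z = ip X (Z *m Y ^t*).
Proof. by rewrite !ip_tr adjmxM adjmxK mulmxA mxtrace_mulC mulmxA. Qed.

Lemma hermP n (A : 'M[R[i]]_n) : A \is hermsymmx <-> A ^t* = A.
Proof.
split=> [/is_hermitianmxP h|h]; first by rewrite [in RHS]h expr0 scale1r.
by apply/is_hermitianmxP; rewrite expr0 scale1r h.
Qed.

Lemma ip_herm_adj n (A X : 'M[R[i]]_n) :
  A \is hermsymmx -> ip A (X ^t*) = ip A X.
Proof. by move=> /hermP {1}<-; rewrite ip_adj. Qed.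

Lemma l2normE n (v : 'cV[R[i]]_n) : l2norm v = Num.sqrt (ip v v).
Proof.
congr Num.sqrt; apply: eq_bigr => i _.
by rewrite big_ord_recl big_ord0 addr0 rdot_cmod.
Qed.

Lemma sqr_l2norm n (v : 'cV[R[i]]_n) : l2norm v ^+ 2 = ip v v.
Proof. by rewrite l2normE sqr_sqrtr ?ip_ge0. Qed.

Lemma sum_sqr_cmod n (v : 'cV[R[i]]_n) :
  \sum_i cmod (v i 0) ^+ 2 = ip v v.
Proof.
by rewrite -sqr_l2norm sqr_sqrtr // sumr_ge0 // => i _; rewrite sqr_ge0.
Qed.

Lemma l2norm_ge0 n (v : 'cV[R[i]]_n) : 0 <= l2norm v.
Proof. exact: sqrtr_ge0. Qed.

Lemma l2norm_le n (v w : 'cV[R[i]]_n) :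
  ip v v <= ip w w -> l2norm v <= l2norm w.
Proof. by move=> h; rewrite !l2normE ler_wsqrtr. Qed.

Lemma l2normZ n (a : R) (v : 'cV[R[i]]_n) :
  l2norm (a%:C *: v) = `|a| * l2norm v.
Proof.
by rewrite !l2normE !ip_lin mulrA -expr2 sqrtrM ?sqr_ge0 // sqrtr_sqr.
Qed.

Lemma l2norm0 n : l2norm (0 : 'cV[R[i]]_n) = 0.
Proof.
by rewrite -(scale0r (0 : 'cV[R[i]]_n)) (l2normZ 0) normr0 mul0r.
Qed.

Lemma l2norm_eq0 n (v : 'cV[R[i]]_n) : l2norm v = 0 -> v = 0.
Proof.
move=> v0; apply/matrixP => i j; rewrite ord1 mxE.
apply: Normc.eq0_normc; apply/eqP; rewrite eq_le cmod_ge0 andbT.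
by rewrite -v0 cmod_le_l2norm.
Qed.

Lemma opnorm_le n (X : 'M[R[i]]_n) (c : R) :
  (forall v, l2norm v <= 1 -> l2norm (X *m v) <= c) -> opnorm X <= c.
Proof.
move=> h; apply: ge_sup; first by case: (has_sup_opnorm X).
by move=> _ [v /= v1 <-]; exact: h.
Qed.

Lemma l2norm_mulmx n (X : 'M[R[i]]_n) v :
  l2norm (X *m v) <= opnorm X * l2norm v.
Proof.
have [v0|v0] := eqVneq (l2norm v) 0.
  by rewrite (l2norm_eq0 v0) mulmx0 !l2norm0 mulr0.
have vp : 0 < l2norm v by rewrite lt_def v0 l2norm_ge0.
rewrite -ler_pdivrMr // mulrC -[_^-1]ger0_norm ?invr_ge0 ?l2norm_ge0 //.
rewrite -l2normZ scalemxAr; apply: ub_le_sup; first by case: (has_sup_opnorm X).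
exists ((l2norm v)^-1%:C *: v) => //=.
by rewrite l2normZ ger0_norm ?invr_ge0 ?l2norm_ge0 // mulVf.
Qed.

Lemma opnorm_contract n (X : 'M[R[i]]_n) v :
  opnorm X <= 1 -> l2norm (X *m v) <= l2norm v.
Proof.
move=> X1; apply: le_trans (l2norm_mulmx X v) _.
by rewrite ler_piMl ?l2norm_ge0.
Qed.

Lemma schur_norm_le n (X : 'M[R[i]]_n) (c : R) :
  (forall Y, opnorm Y <= 1 -> opnorm (schurmx X Y) <= c) -> schur_norm X <= c.
Proof.
move=> h; apply: ge_sup; first by case: (has_sup_schur_norm X).
by move=> _ [v /= v1 <-]; exact: h.
Qed.

Lemma opnorm_schurmx n (X Y : 'M[R[i]]_n) :
  opnorm Y <= 1 -> opnorm (schurmx X Y) <= schur_norm X.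
Proof.
move=> Y1; apply: ub_le_sup; first by case: (has_sup_schur_norm X).
by exists Y.
Qed.

Lemma schur_dual_norm_le n (X : 'M[R[i]]_n) (c : R) :
  (forall Y, schur_norm Y <= 1 -> cmod (\tr (Y ^t* *m X)) <= c) ->
  schur_dual_norm X <= c.
Proof.
move=> h; apply: ge_sup; first by case: (has_sup_schur_dual_norm X).
by move=> _ [v /= v1 <-]; exact: h.
Qed.

Lemma cmod_tr_schur_dual n (X Y : 'M[R[i]]_n) :
  schur_norm Y <= 1 -> cmod (\tr (Y ^t* *m X)) <= schur_dual_norm X.
Proof.
move=> Y1; apply: ub_le_sup; first by case: (has_sup_schur_dual_norm X).
by exists Y.
Qed.

Lemma Re_le_cmod (z : R[i]) : complex.Re z <= cmod z.
Proof.
apply: le_trans (ler_norm _) _; rewrite -lecR.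
by apply: le_trans (normc_ge_Re z) _; rewrite normc_def; case: z.
Qed.

End Norms.

(** * Hermitian matrices between two opposite diagonal matrices *)

Section Dominated.
Context (R : realType) (n : nat).
Implicit Types (gamma : 'rV[R]_n) (A X : 'M[R[i]]_n) (p q v : 'cV[R[i]]_n).

Definition wsqnorm gamma v : R := \sum_i gamma 0 i * cmod (v i 0) ^+ 2.

(** The two Loewner inequalities between [A] and [+- diag gamma], read on the
    quadratic forms: see [loewner_dominated]. *)
Definition dominated gamma A :=
  forall v, `|ip A (v *m v ^t*)| <= wsqnorm gamma v.

Lemma ip_diag gamma v :
  ip (diag_mx (map_mx (real_complex R) gamma)) (v *m v ^t*) = wsqnorm gamma v.
Proof.
rewrite -ip_mulmxl; apply: eq_bigr => i _.
by rewrite big_ord_recl big_ord0 addr0 mul_diag_mx !mxE rdotZl rdot_cmod.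
Qed.

(** The quadratic form of a hermitian matrix at [v] is real, hence equal to its
    pairing with [v v^*]. *)
Lemma psdmx_ip X : X \is hermsymmx ->
  psdmx X <-> forall v, 0 <= ip X (v *m v ^t*).
Proof.
move=> hX.
have formE v : (v ^t* *m X *m v) 0 0 = (ip X (v *m v ^t*))%:C.
  have -> : ip X (v *m v ^t*) = complex.Re ((v ^t* *m X *m v) 0 0).
    by rewrite ip_tr adjmxM adjmxK -mulmxA mxtrace_mulC /mxtrace big_ord1.
  apply/esym/RRe_real/CrealP.
  have -> : Num.conj ((v ^t* *m X *m v) 0 0) = (v ^t* *m X *m v) ^t* 0 0.
    by rewrite !mxE.
  by rewrite !adjmxM adjmxK (hermP X).1 // mulmxA.
split=> [[_ h] v|h]; first by rewrite -ler0c -formE.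
by split=> // v; rewrite formE ler0c.
Qed.

Lemma herm_diag gamma :
  diag_mx (map_mx (real_complex R) gamma) \is hermsymmx.
Proof.
apply/hermP/matrixP => i j; rewrite !mxE eq_sym.
have [->|] := eqVneq i j; last by rewrite !mulr0n rmorph0.
by rewrite !mulr1n conjCE oppr0.
Qed.

Lemma hermD A X : A \is hermsymmx -> X \is hermsymmx -> A + X \is hermsymmx.
Proof.
by move=> /hermP hA /hermP hX; apply/hermP; rewrite linearD map_mxD hA hX.
Qed.

Lemma hermZ (a : R) A : A \is hermsymmx -> a%:C *: A \is hermsymmx.
Proof.
move=> /hermP hA; apply/hermP; rewrite linearZ map_mxZ hA /=.
by rewrite conjCE oppr0.
Qed.

Lemma hermN A : A \is hermsymmx -> - A \is hermsymmx.
Proof. by move=> /(hermZ (-1)); rewrite rmorphN scaleN1r. Qed.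

Lemma ip_rank1D A p q :
  ip A ((p + q) *m (p + q) ^t*) = ip A (p *m p ^t*) + ip A (p *m q ^t*) +
    (ip A (q *m p ^t*) + ip A (q *m q ^t*)).
Proof. by rewrite linearD map_mxD mulmxDl !mulmxDr !ipDr. Qed.

Lemma ip_rank1B A p q :
  ip A ((p - q) *m (p - q) ^t*) = ip A (p *m p ^t*) - ip A (p *m q ^t*) -
    (ip A (q *m p ^t*) - ip A (q *m q ^t*)).
Proof.
rewrite ip_rank1D linearN map_mxN !mulNmx !mulmxN !ipNr.
by ring.
Qed.

Lemma loewner_dominated gamma A : A \is hermsymmx ->
  loewner_le (- diag_mx (map_mx (real_complex R) gamma)) A /\
  loewner_le A (diag_mx (map_mx (real_complex R) gamma)) <->
  dominated gamma A.
Proof.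
move=> hA; have hD := herm_diag gamma.
rewrite /loewner_le opprK !psdmx_ip ?hermD ?hermN //.
split=> [[h1 h2] v|h].
  by have := h1 v; have := h2 v; rewrite ler_norml !ip_lin ip_diag; lra.
by split=> v; have := h v; rewrite ler_norml !ip_lin ip_diag; lra.
Qed.

(** Polarization: [4 Re <A q, p>] is the form at [p + q] minus the form at
    [p - q], and the parallelogram law holds for the weighted norm. This is how
    a bound on the numerical range of [A] becomes a bound on the sesquilinear
    form. *)
Lemma dominated_polar gamma A p q : A \is hermsymmx -> dominated gamma A ->
  2 * ip A (p *m q ^t*) <= wsqnorm gamma p + wsqnorm gamma q.
Proof.
move=> hA dA; have := dA (p + q); have := dA (p - q).
have qp : ip A (q *m p ^t*) = ip A (p *m q ^t*).
  by rewrite -ip_herm_adj // adjmxM adjmxK.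
have pl : wsqnorm gamma (p + q) + wsqnorm gamma (p - q) =
    2 * (wsqnorm gamma p + wsqnorm gamma q).
  by rewrite -!ip_diag ip_rank1B ip_rank1D; lra.
rewrite ip_rank1B ip_rank1D qp !ler_norml.
by lra.
Qed.


Lemma wsqnorm_le gamma v :
  (forall i, gamma 0 i <= 1) -> wsqnorm gamma v <= ip v v.
Proof.
move=> g1; rewrite -sum_sqr_cmod.
by apply: ler_sum => i _; rewrite ler_piMl ?sqr_ge0.
Qed.

(** The conjugate of [D^-1 A D^-1] with [D = diag d]. The conjugation makes
    [\tr (Y^* A)] a value of the form of the Schur product of [Y] with this
    matrix. *)
Definition normalized_conj A (d : 'I_n -> R) : 'M[R[i]]_n :=
  \matrix_(i, j) ((d i * d j)^-1%:C * Num.conj (A i j)).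

(** With [B] the normalized matrix and [u = B q], the square of the norm of [u]
    is the form of [A] at two rescaled vectors, whose weighted norms are at most
    those of [u] and [q]; polarization then gives
    [2 |u|^2 <= |u|^2 + |q|^2]. *)
Lemma opnorm_normalized gamma A (d : 'I_n -> R) :
  A \is hermsymmx -> dominated gamma A ->
  (forall i, 0 < d i) -> (forall i, gamma 0 i <= d i ^+ 2) ->
  opnorm (normalized_conj A d) <= 1.
Proof.
move=> hA dA d0 gd; apply: opnorm_le => q q1; apply: le_trans q1.
apply: l2norm_le; set u := _ *m q.
pose sc (v : 'cV[R[i]]_n) : 'cV[R[i]]_n :=
  \col_i ((d i)^-1%:C * Num.conj (v i 0)).
have wsc v : wsqnorm gamma (sc v) <= ip v v.
  rewrite -sum_sqr_cmod; apply: ler_sum => i _.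
  rewrite mxE cmodM cmod_conj exprMn mulrA ler_piMl ?sqr_ge0 //.
  have -> : cmod (d i)^-1%:C ^+ 2 = (d i ^+ 2)^-1.
    by rewrite /cmod /= expr0n addr0 sqr_sqrtr ?sqr_ge0 // exprVn.
  by rewrite ler_pdivrMr ?exprn_gt0 // mul1r.
have : ip u u = ip A (sc u *m (sc q) ^t*).
  rewrite {1}/u ip_mulmxl; clearbody u.
  apply: eq_bigr => i _; apply: eq_bigr => j _.
  rewrite !mxE !big_ord_recl !big_ord0 !addr0 !mxE.
  move: (u i 0) (q j 0) (A i j) => [a b] [a' b'] [x y].
  rewrite invfM !(rmorphM, conjCK) !conjCE /rdot /=; ring.
have := dominated_polar (sc u) (sc q) hA dA.
by have := wsc u; have := wsc q; lra.
Qed.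

(** With [d] the square root of [gamma] and [B] the normalized matrix, the trace
    of [Y^* A] is the conjugate of the form of the Schur product of [Y] and [B]
    at the vector [d], of norm at most 1, and [B] is a contraction. Since
    [gamma] may vanish somewhere, it is first increased by a small constant,
    which costs an arbitrarily small [e]. *)
Lemma schur_dual_norm_dominated gamma A :
  A \is hermsymmx -> dominated gamma A -> (forall i, 0 <= gamma 0 i) ->
  \sum_i gamma 0 i <= 1 -> schur_dual_norm A <= 1.
Proof.
move=> hA dA g0 g1; apply: schur_dual_norm_le => Y Y1.
apply/ler_addgt0Pr => e e0.
have n1 : 0 < n.+1%:R :> R by rewrite ltr0n.
(* Dividing by [n.+1] keeps the total increase at most [e], even for [n = 0]. *)
pose g' i := gamma 0 i + e / n.+1%:R.
have g'0 i : 0 < g' i by rewrite ltr_wpDl // divr_gt0.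
pose d i := Num.sqrt (g' i).
have d0 i : 0 < d i by rewrite sqrtr_gt0.
have dd i : d i ^+ 2 = g' i by rewrite sqr_sqrtr // ltW.
have B1 : opnorm (normalized_conj A d) <= 1.
  by apply: opnorm_normalized dA d0 _ => // i; rewrite dd lerDl ltW ?divr_gt0.
pose dv : 'cV[R[i]]_n := \col_i (d i)%:C.
have cd i : cmod (d i)%:C = d i.
  by rewrite /cmod /= expr0n addr0 sqrtr_sqr gtr0_norm.
have dv2 : l2norm dv ^+ 2 = \sum_i d i ^+ 2.
  by rewrite sqr_l2norm -sum_sqr_cmod; apply: eq_bigr => i _; rewrite mxE cd.
have dv1 : l2norm dv ^+ 2 <= 1 + e.
  rewrite dv2 (eq_bigr g') => [|i _]; last exact: dd.
  rewrite big_split /= lerD // sumr_const card_ord.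
  rewrite -[_ *+ n]mulr_natr -mulrA ler_piMr ?(ltW e0) //.
  by rewrite [_^-1 * _]mulrC ler_pdivrMr // mul1r ler_nat.
pose w := schurmx Y (normalized_conj A d) *m dv.
have w1 : l2norm w ^+ 2 <= l2norm dv ^+ 2.
  rewrite ler_sqr ?nnegrE ?l2norm_ge0 //; apply: opnorm_contract.
  exact: le_trans (opnorm_schurmx _ B1) Y1.
have -> : \tr (Y ^t* *m A) = Num.conj (\sum_i (d i)%:C * w i 0).
  have -> : \tr (Y ^t* *m A) = \sum_j \sum_i Num.conj (Y i j) * A i j.
    by do ![apply: eq_bigr => ? _; rewrite !mxE].
  rewrite rmorph_sum /= exchange_big; apply: eq_bigr => i _.
  rewrite mxE mulr_sumr rmorph_sum; apply: eq_bigr => j _ /=.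
  rewrite !mxE; have := lt0r_neq0 (d0 i); have := lt0r_neq0 (d0 j).
  move: (d i) (d j) => x y y0 x0.
  rewrite !rmorphM /= conjCK !conj_real fmorphV rmorphM /=.
  by field; rewrite !fmorph_eq0 x0 y0.
rewrite cmod_conj; apply: le_trans (cmod_sum _) _.
have {}w1 : \sum_i cmod (w i 0) ^+ 2 <= 1 + e.
  by rewrite sum_sqr_cmod -sqr_l2norm (le_trans w1 dv1).
rewrite dv2 in dv1.
have : \sum_i cmod ((d i)%:C * w i 0) * 2 <=
    \sum_i (d i ^+ 2 + cmod (w i 0) ^+ 2).
  apply: ler_sum => i _; rewrite cmodM cd.
  by have := sqr_ge0 (d i - cmod (w i 0)); rewrite sqrrB; lra.
by rewrite -mulr_suml big_split /=; lra.
Qed.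

(** The total weight is only bounded by 1, so that the set contains 0; missing
    weight can always be added to one coordinate. *)
Definition diag_dominated A :=
  A \is hermsymmx /\ exists gamma,
    [/\ forall i, 0 <= gamma 0 i, \sum_i gamma 0 i <= 1 & dominated gamma A].

(** For a contraction [B] and vectors [v], [w'] of norm at most 1, the value
    [Re <(Y o B) v, w'>] is the pairing of [Y] with a matrix [Z] whose entries are
    [conj (B i j) * w' i * conj (v j)]. As [Y] is hermitian, [Z] may be replaced
    by its hermitian part [X], and [X] is dominated by the mean of the weights
    [|w' i|^2] and [|v i|^2]: its form at [x] is [Re <B q, p>] where [p] and [q]
    are [w'] and [v] multiplied entrywise by the conjugate of [x], and
    [2 |Re <B q, p>| <= |q|^2 + |p|^2]. *)
Lemma schur_norm_polar Y : Y \is hermsymmx ->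
  (forall X, diag_dominated X -> ip Y X <= 1) -> schur_norm Y <= 1.
Proof.
move=> hY Y1; apply: schur_norm_le => B B1; apply: opnorm_le => v v1.
set w := _ *m v; set l := l2norm w.
have [->|l0] := eqVneq l 0; first exact: ler01.
pose w' := l^-1%:C *: w.
have w'1 : l2norm w' = 1.
  by rewrite l2normZ ger0_norm ?invr_ge0 ?l2norm_ge0 // mulVf.
pose Z : 'M[R[i]]_n := \matrix_(i, j) (Num.conj (B i j) * (w' *m v ^t*) i j).
have -> : l = ip Y Z.
  transitivity (ip w w').
    by rewrite !ip_lin -sqr_l2norm -/l expr2 mulrA mulVf // mul1r.
  rewrite ip_mulmxl; do 2![apply: eq_bigr => ? _].
  by rewrite !mxE rdotMl mulrC.
pose X := 2^-1%:C *: (Z + Z ^t*).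
have -> : ip Y Z = ip Y X by rewrite !ip_lin ip_herm_adj //; lra.
apply: Y1; split.
  apply: hermZ; apply/hermP.
  by rewrite linearD map_mxD adjmxK addrC.
exists (\row_i (2^-1 * (cmod (w' i 0) ^+ 2 + cmod (v i 0) ^+ 2))); split.
- by move=> i; rewrite mxE mulr_ge0 ?addr_ge0 ?sqr_ge0 ?invr_ge0.
- under eq_bigr do rewrite mxE.
  rewrite -mulr_sumr big_split /=.
  have : l2norm v ^+ 2 <= 1 by rewrite expr_le1 ?l2norm_ge0.
  by rewrite !sum_sqr_cmod -!sqr_l2norm w'1; lra.
move=> x.
pose tw (z : 'cV[R[i]]_n) : 'cV[R[i]]_n := \col_i (z i 0 * Num.conj (x i 0)).
have -> : ip X (x *m x ^t*) = ip (B *m tw v) (tw w').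
  have : ip (Z ^t*) (x *m x ^t*) = ip Z (x *m x ^t*).
    by rewrite -ip_adj adjmxK adjmxM adjmxK.
  have : ip Z (x *m x ^t*) = ip (B *m tw v) (tw w').
    rewrite ip_mulmxl; clearbody w'.
    apply: eq_bigr => i _; apply: eq_bigr => j _.
    rewrite !mxE !big_ord_recl !big_ord0 !addr0 !mxE.
    move: (w' i 0) (v j 0) (x i 0) (x j 0) (B i j).
    move=> [? ?] [? ?] [? ?] [? ?] [? ?].
    by rewrite !rmorphM /= !conjCK !conjCE /rdot /=; ring.
  by rewrite !ip_lin; lra.
have : ip (B *m tw v) (B *m tw v) <= ip (tw v) (tw v).
  by rewrite -!sqr_l2norm ler_sqr ?nnegrE ?l2norm_ge0 // opnorm_contract.
have -> : wsqnorm (\row_i (2^-1 * (cmod (w' i 0) ^+ 2 + cmod (v i 0) ^+ 2))) x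
    = 2^-1 * (ip (tw w') (tw w') + ip (tw v) (tw v)).
  rewrite /ip -big_split mulr_sumr; apply: eq_bigr => i _ /=.
  rewrite !big_ord_recl !big_ord0 !addr0 !mxE !rdot_cmod !cmodM !cmod_conj.
  by ring.
rewrite ler_norml.
have := ip_amgm (B *m tw v) (tw w'); have := ip_amgm (B *m tw v) (- tw w').
by rewrite !ip_lin; lra.
Qed.

(** Polarization with [q] the [j]-th basis vector and [p = X q] bounds the square
    norm of the [j]-th column by [gamma j]. *)
Lemma diag_dominated_le1 X : diag_dominated X -> ip X X <= 1.
Proof.
move=> [hX [g [g0 g1 dX]]].
have gle i : g 0 i <= 1.
  apply: le_trans g1; rewrite (bigD1 i) //= lerDl.
  by apply: sumr_ge0 => j _.
apply: le_trans g1; rewrite {1}/ip exchange_big; apply: ler_sum => j _ /=.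
pose e : 'cV[R[i]]_n := delta_mx j 0.
have Xe : ip (X *m e) (X *m e) = \sum_i rdot (X i j) (X i j).
  apply: eq_bigr => i _.
  by rewrite big_ord_recl big_ord0 addr0 -colE !mxE.
have we : wsqnorm g e = g 0 j.
  rewrite /wsqnorm (bigD1 j) //= big1 => [|i ij].
    by rewrite mxE !eqxx /cmod Normc.normc1 expr1n mulr1 addr0.
  by rewrite mxE (negPf ij) cmod0 expr0n mulr0.
have := dominated_polar (X *m e) e hX dX.
by rewrite -ip_mulmxl we -Xe; have := wsqnorm_le (X *m e) gle; lra.
Qed.

Lemma diag_dominated0 : diag_dominated 0.
Proof.
split; first by apply/hermP; rewrite trmx0 map_mx0.
have ip0 Z : ip (0 : 'M[R[i]]_n) Z = 0 by rewrite -(scale0r 0) (ipZl 0) mul0r.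
exists 0; split=> [i||v]; rewrite ?mxE //.
  by rewrite big1 // => i _; rewrite mxE.
by rewrite ip0 normr0 sumr_ge0 // => i _; rewrite mxE mul0r.
Qed.

Lemma diag_dominated_conv X Y t : 0 <= t <= 1 ->
  diag_dominated X -> diag_dominated Y ->
  diag_dominated (X + t%:C *: (Y - X)).
Proof.
move=> /andP[t0 t1] [hX [g [g0 g1 dX]]] [hY [h [h0 h1 dY]]].
split; first by rewrite hermD ?hermZ ?hermD ?hermN.
exists (\row_i ((1 - t) * g 0 i + t * h 0 i)); split.
- by move=> i; rewrite mxE addr_ge0 ?mulr_ge0 ?subr_ge0.
- under eq_bigr do rewrite mxE.
  rewrite big_split -!mulr_sumr /=.
  have : (1 - t) * \sum_i g 0 i <= 1 - t by rewrite ler_piMr ?subr_ge0.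
  have : t * \sum_i h 0 i <= t by rewrite ler_piMr.
  lra.
move=> v.
have -> : wsqnorm (\row_i ((1 - t) * g 0 i + t * h 0 i)) v =
    (1 - t) * wsqnorm g v + t * wsqnorm h v.
  rewrite /wsqnorm !mulr_sumr -big_split; apply: eq_bigr => i _ /=.
  by rewrite mxE; ring.
have -> : ip (X + t%:C *: (Y - X)) (v *m v ^t*) =
    (1 - t) * ip X (v *m v ^t*) + t * ip Y (v *m v ^t*).
  by rewrite !ip_lin; ring.
apply: le_trans (ler_normD _ _) _; rewrite !normrM (ger0_norm t0).
by rewrite ger0_norm ?subr_ge0 // lerD // ler_wpM2l ?subr_ge0.
Qed.

End Dominated.

(** * Separating a point from a bounded convex set *)

Section Separation.
Local Open Scope classical_set_scope.
Context (R : realType) (n : nat).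

(** The direction is [A - k] with [k] a nearly closest point of [K]. Moving
    from [k] towards [X] by a step [t] cannot lower the squared distance to [A] below its infimum [D]; expanding the
    square bounds [ip (A - k) (X - k)] by [D / 2] once [t] is small enough for
    the quadratic term and [k] close enough to optimal, both at the scale of
    [t * D]. On the other side [ip (A - k) (A - k) >= D]. *)
Lemma separation (K : set 'M[R[i]]_n) (A : 'M[R[i]]_n) (M eps : R) :
  K !=set0 ->
  (forall X Y t, 0 <= t <= 1 -> K X -> K Y -> K (X + t%:C *: (Y - X))) ->
  (forall X, K X -> ip X X <= M) ->
  0 < eps -> (forall X, K X -> eps <= ip (A - X) (A - X)) ->
  exists2 k, K k & exists2 c, (forall X, K X -> ip (A - k) X <= c) &
    c < ip (A - k) A.
Proof.
move=> [X0 KX0] Kconv KM eps0 Keps.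
pose E := [set ip (A - X) (A - X) | X in K].
have Elb : lbound E eps by move=> _ [X KX <-]; exact: Keps.
have hE : has_inf E by split; [exists (ip (A - X0) (A - X0)), X0 | exists eps].
pose D := inf E.
have D0 : 0 < D by apply: lt_le_trans eps0 _; apply: lb_le_inf; case: hE.
have DK X : K X -> D <= ip (A - X) (A - X).
  by move=> KX; apply: ge_inf; [case: hE|exists X].
have M0 : 0 <= M by apply: le_trans (KM _ KX0); exact: ip_ge0.
(* The constant 8 serves [tM]: [4 * M] bounds the squared diameter of [K]. *)
pose t := D / (8 * M + D).
have den0 : 0 < 8 * M + D by lra.
have t0 : 0 < t by rewrite divr_gt0.
have t1 : t <= 1 by rewrite ler_pdivrMr // mul1r; lra.
have tM : t * (4 * M) <= D / 2.
  by rewrite /t mulrAC ler_pdivrMr //; nra.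
have [_ [k Kk <-] kD] : exists2 x, E x & x < D + t * D / 2.
  by apply: inf_adherent => //; rewrite !mulr_gt0 ?invr_gt0 ?ltr0n.
exists k => //; exists (ip (A - k) k + D / 2); last first.
  by have := DK k Kk; rewrite !ip_lin; lra.
move=> X KX.
have := DK _ (Kconv k X t _ Kk KX); rewrite t1 ltW // => /(_ isT).
have -> : A - (k + t%:C *: (X - k)) = (A - k) - t%:C *: (X - k).
  by rewrite opprD addrA.
have bd : ip (X - k) (X - k) <= 4 * M.
  have := KM _ KX; have := KM _ Kk; have := ip_ge0 (X + k).
  by rewrite !ip_lin (ipC k X); lra.
have -> : ip (A - k) X = ip (A - k) k + ip (A - k) (X - k).
  by rewrite [ip _ (X - k)]ipDr ipNr; ring.
rewrite lerD2l; move: (A - k) (X - k) bd kD => Y W bd kD.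
rewrite !ip_lin (ipC W Y) => DX.
have {}bd : t * ip W W <= D / 2 by apply: le_trans tM; rewrite ler_pM2l.
rewrite -(ler_pM2l t0).
have : t * (t * ip W W) <= t * (D / 2) by rewrite ler_pM2l.
lra.
Qed.

End Separation.
(** * Closedness of the dominated matrices and the duality argument *)

Section Closedness.
Local Open Scope classical_set_scope.
Context (R : realType) (n : nat).

(** Compactness of the cube, for a family of sets shrinking with [e]: the sets
    generate a filter, and [G] is one of its cluster points. *)
Lemma box_limit (P : R -> set 'rV[R]_n) :
  (forall e g, P e g -> forall i, 0 <= g 0 i <= 1) ->
  (forall e e', e <= e' -> P e `<=` P e') ->
  (forall e, 0 < e -> P e !=set0) ->
  exists G : 'rV[R]_n, forall e, 0 < e ->
    exists2 g, P e g & forall i, `|G 0 i - g 0 i| < e.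
Proof.
move=> Pbox Pmono Pex.
pose box := [set v : 'rV[R]_n | forall i, `[0%R, 1%R]%classic (v ord0 i)].
have cbox : compact box.
  exact: (@rV_compact R n (fun=> `[0%R, 1%R]%classic)
    (fun=> segment_compact (a:=0) (b:=1))).
pose F := filter_from [set e : R | 0 < e] P.
have FF : ProperFilter F.
  apply: filter_from_proper; last exact: Pex.
  apply: filter_from_filter; first by exists 1; rewrite /= ltr01.
  move=> e e' /= e0 e'0; exists (Num.min e e'); first by rewrite /= lt_min e0.
  move=> g Pg; split; apply: (Pmono _ _ _ _ Pg); first by rewrite ge_min lexx.
  by rewrite ge_min lexx orbT.
have Fbox : F box.
  exists 1 => [|g Pg i]; first by rewrite /= ltr01.
  by rewrite /= in_itv /=; exact: Pbox Pg i.
have [G [_ clG]] := cbox F FF Fbox.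
exists G => e e0.
have [] := clG (P e) (ball G e); first by exists e.
  exact: nbhsx_ballx.
move=> g [Pg Gg]; exists g => // i.
by case: Gg => _; exact.
Qed.

Lemma le_of_small (x y C : R) : 0 <= C ->
  (forall e, 0 < e -> x <= y + e * C) -> x <= y.
Proof.
move=> C0 h; apply/ler_addgt0Pr => e e0.
apply: le_trans (h (e / (C + 1)) _) _; first by rewrite divr_gt0 ?ltr_wpDl.
rewrite lerD2l mulrAC ler_pdivrMr ?ltr_wpDl // ler_pM2l //.
by rewrite lerDl.
Qed.

(** A matrix close to [A] gives a weight [g] that dominates [A] up to a small
    error. All the weights lie in the unit cube, and a limit weight dominates [A]
    since the conditions are non-strict and continuous in the weight. *)
Lemma diag_dominated_closed (A : 'M[R[i]]_n) : A \is hermsymmx ->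
  (forall e, 0 < e ->
     exists2 X, diag_dominated X & ip (A - X) (A - X) < e) ->
  diag_dominated A.
Proof.
move=> hA hX; split => //.
pose c (v : 'cV[R[i]]_n) : R := 1 + ip (v *m v ^t*) (v *m v ^t*).
have c0 v : 0 <= c v by rewrite addr_ge0 ?ip_ge0.
pose P (e : R) := [set g : 'rV[R]_n |
  [/\ forall i, 0 <= g 0 i, \sum_i g 0 i <= 1 &
      forall v, `|ip A (v *m v ^t*)| <= wsqnorm g v + e * c v]].
have [||e e0|G hG] := @box_limit P.
- move=> e g [g0 g1 _] i; rewrite g0 (le_trans _ g1) //.
  by rewrite (bigD1 i) //= lerDl sumr_ge0.
- move=> e e' ee' g [g0 g1 gA]; split => // v.
  by apply: le_trans (gA v) _; rewrite lerD2l ler_wpM2r.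
- have [X [_ [g [g0 g1 gX]]] AX] := hX (e ^+ 2) (exprn_gt0 2 e0).
  exists g; split => // v.
  have -> : ip A (v *m v ^t*) = ip X (v *m v ^t*) + ip (A - X) (v *m v ^t*).
    by rewrite !ip_lin; ring.
  apply: le_trans (ler_normD _ _) _; apply: lerD; first exact: gX.
  (* The error term is estimated from [2 |<E, e V>| <= |E|^2 + e^2 |V|^2], where
     [E = A - X] has square norm at most [e^2]. *)
  set V := v *m v ^t*; rewrite -(ler_pM2l e0) -[X in X * `|_|]gtr0_norm //.
  rewrite -normrM ler_norml.
  have := ip_amgm (A - X) (e%:C *: V); have := ip_amgm (A - X) (- (e%:C *: V)).
  have := ip_ge0 (A - X); have := ip_ge0 (e%:C *: V).
  rewrite !(ipNr, ipNl, ipZr, ipZl) /c -/V; move: AX; lra.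
exists G; split.
- move=> i; apply: (@le_of_small _ _ 1) => // e e0.
  have [g [g0 _ _] /(_ i)] := hG e e0.
  by have := g0 i; rewrite ltr_norml; lra.
- apply: (@le_of_small _ _ n%:R) => // e e0.
  have [g [_ g1 _] Gg] := hG e e0.
  apply: (@le_trans _ _ (\sum_i (g 0 i + e))).
    by apply: ler_sum => i _; have := Gg i; rewrite ltr_norml; lra.
  by rewrite big_split sumr_const card_ord -[_ *+ n]mulr_natr lerD2r.
- move=> v; apply: (@le_of_small _ _ (c v + \sum_i cmod (v i 0) ^+ 2)).
    by rewrite addr_ge0 // sumr_ge0 // => i _; rewrite sqr_ge0.
  move=> e e0; have [g [_ _ gA] Gg] := hG e e0.
  apply: le_trans (gA v) _; rewrite [in leRHS]mulrDr addrCA [leLHS]addrC lerD2l.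
  rewrite /wsqnorm mulr_sumr -big_split; apply: ler_sum => i _ /=.
  rewrite -mulrDl ler_wpM2r ?sqr_ge0 //.
  by have := Gg i; rewrite ltr_norml; lra.
Qed.

(** If [A] is not dominated, a separating direction [Y], scaled so that the
    pairing is at most 1 on the dominated matrices and exceeds 1 at [A], has
    Schur norm at most 1 and so contradicts the bound on the dual norm. *)
Lemma diag_dominated_of_schur_dual (A : 'M[R[i]]_n) : A \is hermsymmx ->
  schur_dual_norm A <= 1 -> diag_dominated A.
Proof.
move=> hA A1; apply: contrapT => nK.
have [eps eps0 far] : exists2 eps, 0 < eps &
    forall X, diag_dominated X -> eps <= ip (A - X) (A - X).
  apply: contrapT => hn; apply: nK; apply: diag_dominated_closed => // e e0.
  apply: contrapT => hX; apply: hn; exists e => // X KX.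
  by rewrite leNgt; apply/negP => lt; apply: hX; exists X.
have K0 := @diag_dominated0 R n.
have [||k [hk _] [c cK cA]] :=
  separation _ _ (@diag_dominated_le1 R n) eps0 far.
- by exists 0.
- by move=> X Y t t01 KX KY; exact: diag_dominated_conv.
set Y := A - k in cK cA.
have hY : Y \is hermsymmx by rewrite hermD ?hermN.
have c0 : 0 <= c.
  by have := cK _ K0; rewrite -(scale0r (0 : 'M[R[i]]_n)) (ipZr 0) mul0r.
(* The value [c] may be 0, hence a strictly larger scaling factor. *)
pose s := (c + ip Y A) / 2.
have s0 : 0 < s by rewrite /s; lra.
have cs : c <= s by rewrite /s; lra.
have sA : s < ip Y A by rewrite /s; lra.
have Y1 : schur_norm (s^-1%:C *: Y) <= 1.
  apply: schur_norm_polar; first exact: hermZ.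
  move=> X KX; rewrite ipZl ler_pdivrMl // mulr1.
  exact: le_trans (cK X KX) cs.
have := le_trans (cmod_tr_schur_dual A Y1) A1.
move=> /(le_trans (Re_le_cmod _)); rewrite -ip_tr ipC ipZl.
by rewrite ler_pdivrMl // mulr1 leNgt sA.
Qed.
End Closedness.

Theorem theorem4p1 (R : realType) (n : nat) (n_gt0 : (0 < n)%N)
    (A : 'M[R[i]]_n) (A_sa : A \is hermsymmx) :
  schur_dual_norm A <= 1 <->
  exists gamma : 'rV[R]_n,
    [/\ forall j, 0 <= gamma 0 j,
        \sum_j gamma 0 j = 1,
        loewner_le (- diag_mx (map_mx (real_complex R) gamma)) A &
        loewner_le A (diag_mx (map_mx (real_complex R) gamma))].
Proof.
split=> [A1|[gamma [g0 g1 lA Al]]]; last first.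
  have dA : dominated gamma A by apply/loewner_dominated.
  by apply: schur_dual_norm_dominated dA g0 _ => //; rewrite g1.
have [_ [g [g0 g1 dA]]] := diag_dominated_of_schur_dual A_sa A1.
(* The missing weight [r] goes to the first coordinate. *)
pose i0 := Ordinal n_gt0; pose r := 1 - \sum_i g 0 i.
have r0 : 0 <= r by rewrite subr_ge0.
pose g' : 'rV[R]_n := \row_i (g 0 i + r *+ (i == i0)).
have gg' i : g 0 i <= g' 0 i by rewrite mxE lerDl mulrn_wge0.
have dA' : dominated g' A.
  move=> v; apply: le_trans (dA v) _; apply: ler_sum => i _.
  by rewrite ler_wpM2r ?sqr_ge0.
have [lA Al] := (loewner_dominated g' A_sa).2 dA'.
exists g'; split => // [j|]; first exact: le_trans (g0 j) (gg' j).
under eq_bigr do rewrite mxE.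
rewrite big_split /= [X in _ + X](bigD1 i0) //=.
by rewrite [X in _ + (_ + X)]big1 => [|i /negPf -> //]; rewrite /r; ring.
Qed.
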